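(* Let $S=(-\frac\pi2,\frac\pi2)^2$. For distinct pairs $(p,q)$ and $(p',q')$ of non-negative integers with $p\le q$ and $p'\le q'$, there is at most one value of $h\in[0,+\infty)$ such that $$\lambda_{p,q,h}(S)=\lambda_{p',q',h}(S).$$
   Context: For a non-negative integer $p$ and $h>0$, $\alpha_p=\alpha_p(h)$ denotes the non-zero solution in $[p\pi,(p+1)\pi)$ of $\frac{2\alpha_p}{h\pi}\cos\alpha_p+\left(1-\frac{\alpha_p^2}{h^2\pi^2}\right)\sin\alpha_p=0$; equivalently, $\alpha_p\tan(\alpha_p/2)=h\pi$ if $p$ is even and $\frac{\alpha_p}{h\pi}=-\tan(\alpha_p/2)$ if $p$ is odd. For $h=0$, $\alpha_p(0)=p\pi$. The Robin eigenvalues of $-\Delta$ on $S$ with boundary condition $\partial_\nu u+hu=0$ are the numbers $\lambda_{p,q,h}(S):=\pi^{-2}\left(\alpha_p(h)^2+\alpha_q(h)^2\right)$, for $p,q\in\{0,1,2,\dots\}$. *)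

(* Defs.v *)
From Stdlib Require Import Reals Lra ClassicalEpsilon.
Open Scope R_scope.

Definition robin_char (h a : R) : R :=
  2 * a / (h * PI) * cos a + (1 - a ^ 2 / (h ^ 2 * PI ^ 2)) * sin a.

Definition is_alpha (p : nat) (h a : R) : Prop :=
  INR p * PI <= a < INR (p + 1) * PI /\ a <> 0 /\ robin_char h a = 0.

(* For h > 0 the description is satisfied by exactly one real, see
   [is_alpha_exists_unique]; negative h is junk. *)
Definition alpha (p : nat) (h : R) : R :=
  if Req_EM_T h 0 then INR p * PI else epsilon (inhabits 0) (is_alpha p h).

(* Eigenvalues of -Delta on the square S = (-PI/2, PI/2)^2 with boundary
   condition d_nu u + h u = 0: separation of variables gives products of
   cos (alpha x / PI) or sin (alpha x / PI) in each coordinate. *)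
Definition robin_lambda (p q : nat) (h : R) : R :=
  / PI ^ 2 * (alpha p h ^ 2 + alpha q h ^ 2).

Lemma cos_sin_shift (p : nat) (x : R) :
  cos (x + INR p * PI) = (-1) ^ p * cos x /\
  sin (x + INR p * PI) = (-1) ^ p * sin x.
Proof.
induction p as [|p [IHc IHs]].
- replace (x + INR 0 * PI) with x by (simpl; ring). simpl; lra.
- replace (x + INR (S p) * PI) with ((x + INR p * PI) + PI)
    by (rewrite S_INR; ring).
  rewrite neg_cos, neg_sin, IHc, IHs; simpl; lra.
Qed.

Lemma robin_char_factor (p : nat) (h t : R) :
  0 < h ->
  let a := 2 * t + INR p * PI in
  robin_char h a = (-1) ^ p * (2 / (h * PI) ^ 2)
    * ((h * PI * cos t - a * sin t) * (a * cos t + h * PI * sin t)).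
Proof.
intros Hh a. pose proof PI_RGT_0.
unfold robin_char. unfold a at 2 4.
destruct (cos_sin_shift p (2 * t)) as [-> ->].
rewrite cos_2a, sin_2a. field; lra.
Qed.

Lemma is_alpha_half (p : nat) (h t : R) :
  0 < h -> 0 <= t < PI / 2 ->
  let a := 2 * t + INR p * PI in
  is_alpha p h a <-> a * sin t = h * PI * cos t.
Proof.
intros Hh Ht a. pose proof PI_RGT_0 as HP. pose proof (pos_INR p) as Hp.
assert (Hc : 0 < cos t) by (apply cos_gt_0; lra).
assert (Hs : 0 <= sin t) by (apply sin_ge_0; lra).
assert (HH : 0 < h * PI) by (apply Rmult_lt_0_compat; lra).
assert (Hpp : 0 <= INR p * PI) by (apply Rmult_le_pos; lra).
assert (Hsgn : (-1) ^ p <> 0) by (apply pow_nonzero; lra).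
assert (Hk : 2 / (h * PI) ^ 2 <> 0).
{ apply Rgt_not_eq, Rdiv_lt_0_compat; [lra | apply pow_lt; lra]. }
pose proof (robin_char_factor p h t Hh) as Hf. simpl in Hf. fold a in Hf.
unfold is_alpha. rewrite Hf. split.
- intros (_ & Ha & H0).
  assert (Ha' : 0 < a) by (unfold a in *; lra).
  assert (0 < a * cos t) by (apply Rmult_lt_0_compat; lra).
  assert (0 <= h * PI * sin t) by (apply Rmult_le_pos; lra).
  apply Rmult_integral in H0 as [H0|H0].
  + apply Rmult_integral in H0 as [H0|H0]; simpl in *; lra.
  + apply Rmult_integral in H0 as [H0|H0]; lra.
- intros H0. repeat split.
  + unfold a; lra.
  + rewrite plus_INR; simpl; unfold a; lra.
  + intros E. rewrite E, Rmult_0_l in H0.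
    assert (0 < h * PI * cos t) by (apply Rmult_lt_0_compat; lra). lra.
  + rewrite H0; ring.
Qed.

Lemma is_alpha_exists_unique (p : nat) (h : R) :
  0 < h -> exists! a, is_alpha p h a.
Proof.
intros Hh. pose proof PI_RGT_0 as HP. pose proof (pos_INR p) as Hp.
assert (HH : 0 < h * PI) by (apply Rmult_lt_0_compat; lra).
assert (Hpp : 0 <= INR p * PI) by (apply Rmult_le_pos; lra).
set (f := fun t => (2 * t + INR p * PI) * sin t - h * PI * cos t).
assert (Hcont : continuity f) by (unfold f; reg).
assert (Hmono : forall s t, 0 <= s < t -> t < PI / 2 -> f s < f t).
{ intros s t Hst Ht. unfold f.
  assert (0 <= sin s) by (apply sin_ge_0; lra).
  assert (sin s < sin t) by (apply sin_increasing_1; lra).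
  assert (cos t < cos s) by (apply cos_decreasing_1; lra).
  assert ((2 * s + INR p * PI) * sin s <= (2 * t + INR p * PI) * sin t)
    by (apply Rmult_le_compat; lra).
  assert (h * PI * cos t < h * PI * cos s) by (apply Rmult_lt_compat_l; lra).
  lra. }
assert (Hdecomp : forall a, is_alpha p h a ->
  exists t, 0 <= t < PI / 2 /\ a = 2 * t + INR p * PI /\ f t = 0).
{ intros a Ha. exists ((a - INR p * PI) / 2).
  assert (Ht : 0 <= (a - INR p * PI) / 2 < PI / 2).
  { destruct Ha as [[H1 H2] _]. rewrite plus_INR in H2; simpl in H2; lra. }
  assert (E : a = 2 * ((a - INR p * PI) / 2) + INR p * PI) by field.
  split; [exact Ht | split; [exact E |]].
  rewrite E in Ha. apply (is_alpha_half p h _ Hh Ht) in Ha. unfold f; lra. }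
destruct (IVT f 0 (PI / 2) Hcont) as [t [Ht H0]].
- lra.
- unfold f. rewrite sin_0, cos_0; lra.
- unfold f. rewrite sin_PI2, cos_PI2; lra.
- assert (Ht' : 0 <= t < PI / 2).
  { split; [lra |]. destruct (proj2 Ht) as [|E]; [lra |].
    subst t. unfold f in H0. rewrite sin_PI2, cos_PI2 in H0. lra. }
  exists (2 * t + INR p * PI). split.
  + apply (is_alpha_half p h t Hh Ht'). unfold f in H0; lra.
  + intros a Ha. destruct (Hdecomp a Ha) as (s & Hs & -> & Hfs).
    destruct (Rtotal_order s t) as [L | [-> | L]]; [| lra |].
    * pose proof (Hmono s t ltac:(lra) ltac:(lra)). lra.
    * pose proof (Hmono t s ltac:(lra) ltac:(lra)). lra.
Qed.

Lemma alpha_0 (p : nat) : alpha p 0 = INR p * PI.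
Proof. unfold alpha. destruct (Req_EM_T 0 0); [reflexivity | lra]. Qed.

Lemma alpha_spec (p : nat) (h : R) : 0 < h -> is_alpha p h (alpha p h).
Proof.
intros Hh. unfold alpha. destruct (Req_EM_T h 0) as [|_]; [lra |].
apply epsilon_spec.
destruct (is_alpha_exists_unique p h Hh) as [a [Ha _]]. now exists a.
Qed.

(* Main.v *)
Require Import Defs.
From Stdlib Require Import Reals.
From Stdlib Require Import Lra Lia Ranalysis5.
From Coquelicot Require Import Coquelicot.
Open Scope R_scope.

(** Write [k = h PI] and [x_p = alpha_p(h)^2].  Each [alpha_p] solves
    [a tan ((a - p PI) / 2) = k], and differentiating this relation in [k]
    eliminates [p]: every [x_p] is a solution of one and the same equation
    [dx/dk = 4 x / (x + k^2 + 2 k)] ([alpha_sq_derive]).  Hence, with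
    [c = k^2 + 2 k], the gap between two such solutions obeys
<<
  d/dk ln (x_n - x_m) = 4 c / ((x_m + c) (x_n + c)),
>>
    and the right-hand side decreases strictly when [x_m] and [x_n] both grow.
    So for [m < n <= r < s] the ratio [(x_n - x_m) / (x_s - x_r)] increases
    strictly with [h] ([ln_gap_ratio_increasing]) and takes the value 1 at most
    once.

    Since [x_p] increases strictly with [p], an equality
    [x_p + x_q = x_p' + x_q'] between distinct ordered pairs forces one pair to
    enclose the other, say [p < p' <= q' < q]; it then says exactly that the
    ratio [(x_p' - x_p) / (x_q - x_q')] is 1.

    Comparing two values of [h] in place of looking at the sign of the
    derivative of [x_p + x_q - x_p' - x_q'] at a zero treats [h = 0] like any
    other value, although that derivative vanishes at [h = 0] when
    [p > 0].  All that is required at [h = 0] is continuity, which follows from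
    the Lipschitz bound [alpha_sq_Lipschitz]. *)

(** * The transcendental equation *)

Lemma alpha_bounds (p : nat) (h : R) :
  0 <= h -> INR p * PI <= alpha p h < INR (p + 1) * PI.
Proof.
  pose proof PI_RGT_0 as HP.
  intros [Hh | <-].
  - apply (alpha_spec p h Hh).
  - rewrite alpha_0, plus_INR; simpl; lra.
Qed.

Lemma alpha_nonneg (p : nat) (h : R) : 0 <= h -> 0 <= alpha p h.
Proof.
  intros Hh. pose proof PI_RGT_0. pose proof (pos_INR p).
  destruct (alpha_bounds p h Hh) as [Hl _].
  assert (0 <= INR p * PI) by (apply Rmult_le_pos; lra). lra.
Qed.

Lemma alpha_pos (p : nat) (h : R) : 0 < h -> 0 < alpha p h.
Proof.
  intros Hh. destruct (alpha_spec p h Hh) as (_ & Hne & _).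
  pose proof (alpha_nonneg p h ltac:(lra)). lra.
Qed.

Lemma alpha_lt_index (p q : nat) (h : R) :
  (p < q)%nat -> 0 <= h -> alpha p h < alpha q h.
Proof.
  intros Hpq Hh. pose proof PI_RGT_0.
  destruct (alpha_bounds p h Hh) as [_ Hu].
  destruct (alpha_bounds q h Hh) as [Hl _].
  assert (INR (p + 1) <= INR q) by (apply le_INR; lia).
  assert (INR (p + 1) * PI <= INR q * PI) by (apply Rmult_le_compat_r; lra).
  lra.
Qed.

(** The equation for [alpha] solved for the half-angle: unlike the tangent,
    [atan] is monotone and Lipschitz on the whole line, so two values of [h]
    can be compared directly. *)
Lemma alpha_fixpoint (p : nat) (h : R) :
  0 <= h -> alpha p h = INR p * PI + 2 * atan (h * PI / alpha p h).
Proof.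
  pose proof PI_RGT_0 as HP.
  intros [Hh | <-].
  - pose proof (alpha_pos p h Hh) as Ha.
    destruct (alpha_bounds p h ltac:(lra)) as [Hl Hu].
    rewrite plus_INR in Hu; simpl in Hu.
    set (t := (alpha p h - INR p * PI) / 2).
    assert (Ht : 0 <= t < PI / 2) by (unfold t; lra).
    assert (E : 2 * t + INR p * PI = alpha p h) by (unfold t; field).
    pose proof (alpha_spec p h Hh) as Hspec. rewrite <- E in Hspec.
    apply (is_alpha_half p h t Hh Ht) in Hspec. rewrite E in Hspec.
    assert (Hc : 0 < cos t) by (apply cos_gt_0; lra).
    replace (h * PI / alpha p h) with (tan t).
    + rewrite atan_tan by lra. lra.
    + unfold tan. apply (Rmult_eq_reg_r (alpha p h * cos t)).
      * field_simplify; lra.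
      * apply Rgt_not_eq, Rmult_lt_0_compat; lra.
  - (* For [p = 0] the quotient is [0 / 0], and its value 0 is the right one. *)
    rewrite alpha_0. unfold Rdiv. rewrite !Rmult_0_l, atan_0. ring.
Qed.

(** * Continuity of the squared frequencies *)

Lemma atan_le (x y : R) : x <= y -> atan x <= atan y.
Proof.
  intros [H | ->]; [left; now apply atan_increasing | lra].
Qed.

Lemma atan_sub_le (x y : R) : x <= y -> atan y - atan x <= y - x.
Proof.
  intros Hxy.
  destruct (MVT_gen atan x y (fun z => / (1 + z ^ 2))) as (c & _ & ->).
  - intros z _. apply is_derive_Reals, derivable_pt_lim_atan.
  - intros z _. apply derivable_continuous_pt, derivable_pt_atan.
  - assert (1 <= 1 + c ^ 2) by (pose proof (pow2_ge_0 c); lra).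
    assert (/ (1 + c ^ 2) <= 1).
    { rewrite <- Rinv_1. apply Rinv_le_contravar; lra. }
    replace (y - x) with (1 * (y - x)) at 2 by ring.
    apply Rmult_le_compat_r; lra.
Qed.

Lemma alpha_le (p : nat) (h1 h2 : R) :
  0 <= h1 <= h2 -> alpha p h1 <= alpha p h2.
Proof.
  intros Hh. pose proof PI_RGT_0 as HP.
  destruct (Rle_or_lt (alpha p h1) (alpha p h2)) as [H | H]; [exact H | exfalso].
  pose proof (alpha_fixpoint p h1 ltac:(lra)) as E1.
  pose proof (alpha_fixpoint p h2 ltac:(lra)) as E2.
  destruct (Rle_lt_or_eq_dec 0 h2 ltac:(lra)) as [Hp | Hz].
  - pose proof (alpha_pos p h2 Hp).
    assert (h1 * PI / alpha p h1 <= h2 * PI / alpha p h2).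
    { unfold Rdiv. apply Rmult_le_compat.
      - apply Rmult_le_pos; lra.
      - left; apply Rinv_0_lt_compat; lra.
      - apply Rmult_le_compat_r; lra.
      - apply Rinv_le_contravar; lra. }
    pose proof (atan_le _ _ H1). lra.
  - assert (h1 = h2) by lra. subst h1. lra.
Qed.

(** The square of [alpha_p].  The absolute value replaces the meaningless values
    for negative [h] by an even extension, which makes the function continuous
    on the whole line and in particular at 0. *)
Definition alpha_sq (p : nat) (h : R) : R := alpha p (Rabs h) ^ 2.

Lemma alpha_sq_nonneg_arg (p : nat) (h : R) :
  0 <= h -> alpha_sq p h = alpha p h ^ 2.
Proof. intros Hh. unfold alpha_sq. now rewrite Rabs_pos_eq. Qed.

Lemma alpha_sq_pos (p : nat) (h : R) : 0 < h -> 0 < alpha_sq p h.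
Proof.
  intros Hh. rewrite alpha_sq_nonneg_arg by lra.
  apply pow_lt. now apply alpha_pos.
Qed.

Lemma alpha_sq_lt_index (p q : nat) (h : R) :
  (p < q)%nat -> alpha_sq p h < alpha_sq q h.
Proof.
  intros Hpq. unfold alpha_sq.
  pose proof (Rabs_pos h) as Hh.
  pose proof (alpha_nonneg p _ Hh). pose proof (alpha_lt_index p q _ Hpq Hh).
  apply Rlt_0_minus.
  replace (_ - _) with ((alpha q (Rabs h) - alpha p (Rabs h))
    * (alpha q (Rabs h) + alpha p (Rabs h))) by ring.
  apply Rmult_lt_0_compat; lra.
Qed.

Lemma alpha_sq_le_index (p q : nat) (h : R) :
  (p <= q)%nat -> alpha_sq p h <= alpha_sq q h.
Proof.
  intros Hpq. destruct (Nat.eq_dec p q) as [-> | Hne]; [lra |].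
  left; apply alpha_sq_lt_index; lia.
Qed.

(** With [a_i = alpha p h_i] and [a1 <= a2], the fixed-point equation gives
    [a2 - a1 <= 2 (atan (k2 / a2) - atan (k1 / a2)) <= 2 (k2 - k1) / a2];
    multiplying by [a1 + a2 <= 2 a2] removes the denominator.  So the square is
    Lipschitz up to [h = 0], where [alpha 0] itself behaves like a square
    root. *)
Lemma alpha_sq_increment (p : nat) (h1 h2 : R) :
  0 <= h1 <= h2 ->
  0 <= alpha p h2 ^ 2 - alpha p h1 ^ 2 <= 4 * PI * (h2 - h1).
Proof.
  intros Hh. pose proof PI_RGT_0 as HP.
  destruct (Rle_lt_or_eq_dec 0 h2 ltac:(lra)) as [Hp | Hz].
  2: { assert (h1 = h2) by lra. subst h1. lra. }
  pose proof (alpha_le p h1 h2 Hh) as Hle.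
  pose proof (alpha_nonneg p h1 ltac:(lra)) as H1.
  pose proof (alpha_pos p h2 Hp) as H2.
  assert (Hatan : atan (h1 * PI / alpha p h2) <= atan (h1 * PI / alpha p h1)).
  { destruct (Rle_lt_or_eq_dec 0 h1 ltac:(lra)) as [Hp1 | <-].
    - apply atan_le. unfold Rdiv. apply Rmult_le_compat_l.
      + apply Rmult_le_pos; lra.
      + apply Rinv_le_contravar; [now apply alpha_pos | exact Hle].
    - unfold Rdiv. rewrite !Rmult_0_l. lra. }
  assert (Hq : h1 * PI / alpha p h2 <= h2 * PI / alpha p h2).
  { unfold Rdiv. apply Rmult_le_compat_r.
    - left; now apply Rinv_0_lt_compat.
    - apply Rmult_le_compat_r; lra. }
  pose proof (atan_sub_le _ _ Hq) as Hlip.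
  pose proof (alpha_fixpoint p h1 ltac:(lra)) as E1.
  pose proof (alpha_fixpoint p h2 ltac:(lra)) as E2.
  assert (Hd : alpha p h2 - alpha p h1
               <= 2 * (h2 * PI / alpha p h2 - h1 * PI / alpha p h2)) by lra.
  apply (Rmult_le_compat_r (alpha p h2)) in Hd; [| lra].
  replace (2 * _ * _) with (2 * PI * (h2 - h1)) in Hd by (field; lra).
  split; [nra |].
  assert ((alpha p h2 - alpha p h1) * alpha p h1
          <= (alpha p h2 - alpha p h1) * alpha p h2)
    by (apply Rmult_le_compat_l; lra).
  nra.
Qed.

Lemma alpha_sq_Lipschitz (p : nat) (h1 h2 : R) :
  Rabs (alpha_sq p h2 - alpha_sq p h1) <= 4 * PI * Rabs (h2 - h1).
Proof.
  pose proof PI_RGT_0 as HP.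
  apply Rle_trans with (4 * PI * Rabs (Rabs h2 - Rabs h1)).
  2: { apply Rmult_le_compat_l; [lra | apply Rabs_triang_inv2]. }
  unfold alpha_sq.
  pose proof (Rabs_pos h1). pose proof (Rabs_pos h2).
  destruct (Rle_or_lt (Rabs h1) (Rabs h2)) as [L | L].
  - pose proof (alpha_sq_increment p (Rabs h1) (Rabs h2) ltac:(lra)).
    rewrite !Rabs_pos_eq with (x := _ - _) by lra. lra.
  - pose proof (alpha_sq_increment p (Rabs h2) (Rabs h1) ltac:(lra)).
    rewrite Rabs_minus_sym, (Rabs_minus_sym (Rabs h2)).
    rewrite !Rabs_pos_eq with (x := _ - _) by lra. lra.
Qed.

Lemma alpha_sq_continuous (p : nat) (h : R) : continuity_pt (alpha_sq p) h.
Proof.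
  pose proof PI_RGT_0 as HP.
  intros eps Heps. exists (eps / (4 * PI)). split.
  - apply Rdiv_lt_0_compat; lra.
  - intros y [_ Hy]. simpl in *. unfold R_dist in *.
    apply Rle_lt_trans with (1 := alpha_sq_Lipschitz p h y).
    apply (Rmult_lt_compat_l (4 * PI)) in Hy; [| lra].
    replace (4 * PI * (eps / (4 * PI))) with eps in Hy by (field; lra).
    exact Hy.
Qed.

(** * The common differential equation *)

(** The inverse of [alpha_sq p] on the positive half-line, read off from
    [a tan ((a - p PI) / 2) = h PI] with [a = sqrt x]. *)
Definition robin_parameter (p : nat) (x : R) : R :=
  sqrt x * tan ((sqrt x - INR p * PI) / 2) / PI.

Lemma sqrt_alpha_sq (p : nat) (h : R) :
  0 <= h -> sqrt (alpha_sq p h) = alpha p h.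
Proof.
  intros Hh. rewrite alpha_sq_nonneg_arg by exact Hh.
  rewrite sqrt_pow2; [reflexivity | now apply alpha_nonneg].
Qed.

Lemma tan_half_alpha (p : nat) (h : R) :
  0 <= h -> tan ((alpha p h - INR p * PI) / 2) = h * PI / alpha p h.
Proof.
  intros Hh. rewrite (alpha_fixpoint p h Hh) at 1.
  replace ((_ - _) / 2) with (atan (h * PI / alpha p h)) by field.
  apply tan_atan.
Qed.

Lemma robin_parameter_alpha_sq (p : nat) (h : R) :
  0 < h -> robin_parameter p (alpha_sq p h) = h.
Proof.
  intros Hh. pose proof PI_RGT_0. pose proof (alpha_pos p h Hh).
  unfold robin_parameter. rewrite sqrt_alpha_sq, tan_half_alpha by lra.
  field; lra.
Qed.

Lemma robin_parameter_derive (p : nat) (x : R) :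
  0 < x -> INR p * PI <= sqrt x < INR (p + 1) * PI ->
  is_derive (robin_parameter p) x
    ((tan ((sqrt x - INR p * PI) / 2)
      + sqrt x / 2 * (1 + tan ((sqrt x - INR p * PI) / 2) ^ 2))
     / (2 * sqrt x * PI)).
Proof.
  intros Hx Hs. pose proof PI_RGT_0.
  rewrite plus_INR in Hs; simpl in Hs.
  assert (Hc : 0 < cos ((sqrt x - INR p * PI) / 2)) by (apply cos_gt_0; lra).
  pose proof (sqrt_lt_R0 x Hx).
  pose proof (is_derive_tan _ (Rgt_not_eq _ _ Hc)) as Htan.
  unfold robin_parameter. auto_derive.
  - repeat split; try exact Hx. eexists; exact Htan.
  - change (Derive (fun y => tan y)) with (Derive tan).
    change ((sqrt x + - (INR p * PI)) * / 2)
      with ((sqrt x - INR p * PI) / 2).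
    rewrite (is_derive_unique _ _ _ Htan). field; lra.
Qed.

(** The relation [sqrt x * tan ((sqrt x - p PI) / 2) = h PI] expresses the
    tangent, and with it the derivative of [robin_parameter], through [x] and
    [h] alone: this is where the index [p] drops out. *)
Lemma alpha_sq_derive (p : nat) (h : R) :
  0 < h ->
  is_derive (alpha_sq p) h
    (4 * PI * alpha_sq p h / (alpha_sq p h + (h * PI) ^ 2 + 2 * (h * PI))).
Proof.
  intros Hh. pose proof PI_RGT_0 as HP.
  assert (Hrange : forall a,
    alpha_sq p (h / 2) <= a <= alpha_sq p (2 * h) ->
    0 < a /\ INR p * PI <= sqrt a < INR (p + 1) * PI).
  { intros a [Ha1 Ha2].
    pose proof (alpha_sq_pos p (h / 2) ltac:(lra)). split; [lra |].
    apply sqrt_le_1_alt in Ha1, Ha2.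
    rewrite sqrt_alpha_sq in Ha1, Ha2 by lra.
    pose proof (alpha_bounds p (h / 2) ltac:(lra)).
    pose proof (alpha_bounds p (2 * h) ltac:(lra)).
    lra. }
  assert (Hder : forall a,
    alpha_sq p (h / 2) <= a <= alpha_sq p (2 * h) ->
    derivable_pt (robin_parameter p) a).
  { intros a Ha. destruct (Hrange a Ha) as [H0 Hs].
    apply ex_derive_Reals_0. eexists. now apply robin_parameter_derive. }
  assert (Hmid : alpha_sq p (h / 2) <= alpha_sq p h <= alpha_sq p (2 * h)).
  { rewrite !alpha_sq_nonneg_arg by lra.
    pose proof (alpha_sq_increment p (h / 2) h ltac:(lra)).
    pose proof (alpha_sq_increment p h (2 * h) ltac:(lra)). lra. }
  pose proof (alpha_pos p h Hh) as Ha.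
  assert (HH : 0 < h * PI) by (apply Rmult_lt_0_compat; lra).
  assert (Hval : derive_pt (robin_parameter p) (alpha_sq p h) (Hder _ Hmid)
    = (alpha_sq p h + (h * PI) ^ 2 + 2 * (h * PI)) / (4 * PI * alpha_sq p h)).
  { apply derive_pt_eq_0, is_derive_Reals.
    destruct (Hrange _ Hmid) as [H0 Hs].
    pose proof (robin_parameter_derive p _ H0 Hs) as Hd.
    rewrite sqrt_alpha_sq, tan_half_alpha in Hd by lra.
    rewrite (alpha_sq_nonneg_arg p h) in * by lra.
    replace (_ / (4 * PI * _)) with
      ((h * PI / alpha p h + alpha p h / 2 * (1 + (h * PI / alpha p h) ^ 2))
       / (2 * alpha p h * PI)) by (field; lra).
    exact Hd. }
  pose proof (alpha_sq_pos p h Hh) as Hx.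
  assert (0 < alpha_sq p h + (h * PI) ^ 2 + 2 * (h * PI))
    by (pose proof (pow2_ge_0 (h * PI)); lra).
  apply is_derive_Reals.
  replace (_ / _) with
    (1 / derive_pt (robin_parameter p) (alpha_sq p h) (Hder _ Hmid))
    by (rewrite Hval; field; repeat split; lra).
  apply derivable_pt_lim_recip_interv with (lb := h / 2) (ub := 2 * h); try lra.
  - apply alpha_sq_continuous.
  - intros y Hy. unfold comp, id. apply robin_parameter_alpha_sq. lra.
  - rewrite Hval. apply Rgt_not_eq, Rdiv_lt_0_compat; [assumption |].
    apply Rmult_lt_0_compat; lra.
Qed.

(** * Comparison of gaps *)

(** The strict mean value criterion with the derivative known in the interior
    only, as is the case for [alpha_sq] on intervals starting at 0. *)
Lemma derive_pos_strictly_increasing (f df : R -> R) (a b : R) :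
  a < b ->
  (forall x, a < x < b -> is_derive f x (df x) /\ 0 < df x) ->
  (forall x, a <= x <= b -> continuity_pt f x) ->
  f a < f b.
Proof.
  intros Hab Hd Hc.
  assert (pr : forall x, a < x < b -> derivable_pt f x).
  { intros x Hx. apply ex_derive_Reals_0. exists (df x). now apply Hd. }
  destruct (MVT f id a b pr (fun x _ => derivable_pt_id x) Hab Hc)
    as (c & P & E).
  - intros x _. apply derivable_continuous_pt, derivable_pt_id.
  - destruct (Hd c P) as [Hdc Hpos].
    rewrite derive_pt_id in E. unfold id in E.
    rewrite (derive_pt_eq_0 _ _ _ (pr c P) (proj1 (is_derive_Reals _ _ _) Hdc))
      in E.
    assert (0 < (b - a) * df c) by (apply Rmult_lt_0_compat; lra). lra.
Qed.

Definition ln_gap (m n : nat) (h : R) : R := ln (alpha_sq n h - alpha_sq m h).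

Lemma ln_gap_continuous (m n : nat) (h : R) :
  (m < n)%nat -> continuity_pt (ln_gap m n) h.
Proof.
  intros Hmn. pose proof (alpha_sq_lt_index m n h Hmn).
  apply (continuity_pt_comp (fun y => alpha_sq n y - alpha_sq m y) ln).
  - apply continuity_pt_minus; apply alpha_sq_continuous.
  - apply derivable_continuous_pt. exists (/ (alpha_sq n h - alpha_sq m h)).
    apply derivable_pt_lim_ln. lra.
Qed.

(** With [c = (h PI)^2 + 2 h PI] the right-hand side of the differential
    equation is [4 PI (1 - c / (x + c))], so its difference at two solutions is
    a multiple of their gap. *)
Lemma ln_gap_derive (m n : nat) (h : R) :
  (m < n)%nat -> 0 < h ->
  let c := (h * PI) ^ 2 + 2 * (h * PI) in
  is_derive (ln_gap m n) h
    (4 * PI * c / ((alpha_sq m h + c) * (alpha_sq n h + c))).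
Proof.
  intros Hmn Hh c. pose proof PI_RGT_0.
  pose proof (alpha_sq_lt_index m n h Hmn).
  pose proof (alpha_sq_pos m h Hh). pose proof (alpha_sq_pos n h Hh).
  assert (0 < h * PI) by (apply Rmult_lt_0_compat; lra).
  assert (0 < c) by (unfold c; pose proof (pow2_ge_0 (h * PI)); lra).
  replace (_ / _) with
    ((4 * PI * alpha_sq n h / (alpha_sq n h + c)
      - 4 * PI * alpha_sq m h / (alpha_sq m h + c))
     * / (alpha_sq n h - alpha_sq m h)) by (field; lra).
  unfold ln_gap.
  apply (is_derive_comp ln (fun y => alpha_sq n y - alpha_sq m y)).
  - apply is_derive_Reals, derivable_pt_lim_ln. lra.
  - unfold c. rewrite <- !Rplus_assoc.
    apply (is_derive_minus (alpha_sq n) (alpha_sq m));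
      now apply alpha_sq_derive.
Qed.

(** By [ln_gap_derive] the lower gap has the larger logarithmic derivative. *)
Lemma ln_gap_ratio_increasing (m n r s : nat) (h1 h2 : R) :
  (m < n)%nat -> (n <= r)%nat -> (r < s)%nat -> 0 <= h1 < h2 ->
  ln_gap m n h1 - ln_gap r s h1 < ln_gap m n h2 - ln_gap r s h2.
Proof.
  intros Hmn Hnr Hrs Hh. pose proof PI_RGT_0.
  apply (derive_pos_strictly_increasing
    (fun h => ln_gap m n h - ln_gap r s h)
    (fun h => let c := (h * PI) ^ 2 + 2 * (h * PI) in
      4 * PI * c / ((alpha_sq m h + c) * (alpha_sq n h + c))
      - 4 * PI * c / ((alpha_sq r h + c) * (alpha_sq s h + c)))); [lra | |].
  - intros h Hx. assert (Hh0 : 0 < h) by lra. split.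
    + apply (is_derive_minus (ln_gap m n) (ln_gap r s));
        now apply ln_gap_derive.
    + cbv zeta beta. set (c := (h * PI) ^ 2 + 2 * (h * PI)).
      assert (0 < h * PI) by (apply Rmult_lt_0_compat; lra).
      assert (0 < c) by (unfold c; pose proof (pow2_ge_0 (h * PI)); lra).
      pose proof (alpha_sq_pos m h Hh0).
      pose proof (alpha_sq_lt_index m n h Hmn).
      pose proof (alpha_sq_le_index n r h Hnr).
      pose proof (alpha_sq_lt_index r s h Hrs).
      apply Rlt_0_minus. unfold Rdiv. apply Rmult_lt_compat_l.
      * apply Rmult_lt_0_compat; lra.
      * apply Rinv_lt_contravar.
        -- repeat apply Rmult_lt_0_compat; lra.
        -- apply Rmult_gt_0_lt_compat; lra.
  - intros h _. apply (continuity_pt_minus (ln_gap m n) (ln_gap r s));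
      now apply ln_gap_continuous.
Qed.

(** * Coincidences of eigenvalues *)

Lemma robin_lambda_eq (p q p' q' : nat) (h : R) :
  0 <= h -> robin_lambda p q h = robin_lambda p' q' h ->
  alpha_sq p h + alpha_sq q h = alpha_sq p' h + alpha_sq q' h.
Proof.
  intros Hh E. pose proof PI_RGT_0.
  unfold robin_lambda in E. apply Rmult_eq_reg_l in E.
  - rewrite !alpha_sq_nonneg_arg by exact Hh. exact E.
  - apply Rinv_neq_0_compat, pow_nonzero. lra.
Qed.

(** The sum is strictly monotone in each index, so neither pair can dominate the
    other componentwise. *)
Lemma enclosing_pairs (p q p' q' : nat) (h : R) :
  (p, q) <> (p', q') ->
  alpha_sq p h + alpha_sq q h = alpha_sq p' h + alpha_sq q' h ->
  (p < p' /\ q' < q)%nat \/ (p' < p /\ q < q')%nat.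
Proof.
  intros Hne E.
  destruct (Nat.lt_trichotomy p p') as [Hp | [Hp | Hp]];
  destruct (Nat.lt_trichotomy q q') as [Hq | [Hq | Hq]];
  try (now left); try (now right);
  try (exfalso; apply Hne; now subst);
  exfalso; try subst p'; try subst q';
  try apply (alpha_sq_lt_index _ _ h) in Hp;
  try apply (alpha_sq_lt_index _ _ h) in Hq; lra.
Qed.

Lemma enclosing_coincidence_absurd (p q p' q' : nat) (h1 h2 : R) :
  (p < p')%nat -> (p' <= q')%nat -> (q' < q)%nat -> 0 <= h1 < h2 ->
  alpha_sq p h1 + alpha_sq q h1 = alpha_sq p' h1 + alpha_sq q' h1 ->
  alpha_sq p h2 + alpha_sq q h2 = alpha_sq p' h2 + alpha_sq q' h2 ->
  False.
Proof.
  intros Hp Hm Hq Hh E1 E2.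
  pose proof (ln_gap_ratio_increasing p p' q' q h1 h2 Hp Hm Hq Hh) as H.
  unfold ln_gap in H.
  replace (alpha_sq p' h1 - alpha_sq p h1)
    with (alpha_sq q h1 - alpha_sq q' h1) in H by lra.
  replace (alpha_sq p' h2 - alpha_sq p h2)
    with (alpha_sq q h2 - alpha_sq q' h2) in H by lra.
  lra.
Qed.

Theorem proposition7p1 (p q p' q' : nat)
  (Hpq : (p <= q)%nat) (Hpq' : (p' <= q')%nat) (Hne : (p, q) <> (p', q'))
  (h1 h2 : R) (Hh1 : 0 <= h1) (Hh2 : 0 <= h2)
  (Heq1 : robin_lambda p q h1 = robin_lambda p' q' h1)
  (Heq2 : robin_lambda p q h2 = robin_lambda p' q' h2) :
  h1 = h2.
Proof.
  apply robin_lambda_eq in Heq1; [| exact Hh1].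
  apply robin_lambda_eq in Heq2; [| exact Hh2].
  destruct (enclosing_pairs p q p' q' h1 Hne Heq1) as [[Hp Hq] | [Hp Hq]];
  destruct (Rtotal_order h1 h2) as [L | [E | L]]; try exact E; exfalso.
  - now apply (enclosing_coincidence_absurd p q p' q' h1 h2).
  - now apply (enclosing_coincidence_absurd p q p' q' h2 h1).
  - now apply (enclosing_coincidence_absurd p' q' p q h1 h2).
  - now apply (enclosing_coincidence_absurd p' q' p q h2 h1).
Qed.
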